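(* Let $d \geq 1$ and let $\mu$ be a probability measure on $\mathbb{Z}^d$ which has a finite super-exponential moment. Then every point-wise limit of non-negative harmonic functions on $\mathbb{Z}^d$ relative to $\mu$ is harmonic relative to $\mu$; that is, if $(f_n)$ is a sequence of functions $\mathbb{Z}^d \to \mathbb{R}_+$ harmonic relative to $\mu$ and $f : \mathbb{Z}^d \to \mathbb{R}_+$ satisfies $f_n(x) \to f(x)$ for every $x \in \mathbb{Z}^d$, then $f$ is harmonic relative to $\mu$.
   Context: Here $\mathbb{R}_+ = [0,+\infty)$. Given a probability measure $\mu$ on $\mathbb{Z}^d$, a function $f : \mathbb{Z}^d \to \mathbb{R}_+$ is called harmonic relative to $\mu$ if $f(x_0) = \int_{\mathbb{Z}^d} f(x_0 + x)\, d\mu(x)$ for every $x_0 \in \mathbb{Z}^d$. The integrals of non-negative functions take values in $[0,+\infty]$. A probability measure $\mu$ on $\mathbb{Z}^d$ has a finite super-exponential moment if there exist $\varepsilon > 0$ and a norm $|\cdot|$ on $\mathbb{R}^d$ such that $\int_{\mathbb{Z}^d} e^{|x|^{1+\varepsilon}}\, d\mu(x) < +\infty$. *)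

(* Defs.v *)
From HB Require Import structures.
From mathcomp Require Import all_boot all_order all_algebra.
From mathcomp Require Import all_classical all_reals all_analysis.

Set Implicit Arguments.
Unset Strict Implicit.
Unset Printing Implicit Defensive.

Import Order.TTheory GRing.Theory Num.Theory.
Import numFieldNormedType.Exports.

Local Open Scope classical_set_scope.
Local Open Scope ring_scope.

(* The lattice Z^d with its discrete sigma-algebra, as an alias of the row
   vectors so that the instance below does not apply to all matrices. *)
Definition lattice (d : nat) : Type := 'rV[int]_d.

HB.instance Definition _ (d : nat) := GRing.Zmodule.on (lattice d).
HB.instance Definition _ (d : nat) := isPointed.Build (lattice d) 0.
HB.instance Definition _ (d : nat) := @isMeasurable.Build
  default_measure_display (lattice d) (@discrete_measurable (lattice d))
  (@discrete_measurable0 (lattice d)) (@discrete_measurableC (lattice d))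
  (@discrete_measurableU (lattice d)).

Definition lattice_to_real (R : realType) (d : nat) (x : lattice d) : 'rV[R]_d :=
  map_mx intr (x : 'rV[int]_d).

(* An arbitrary norm on R^d; `|v| would be the sup norm. *)
Definition is_norm (R : realType) (d : nat) (N : 'rV[R]_d -> R) : Prop :=
  [/\ forall v, 0 <= N v,
      forall v, N v = 0 -> v = 0,
      forall (a : R) v, N (a *: v) = `|a| * N v
    & forall v w, N (v + w) <= N v + N w].

Definition finite_superexp_moment (R : realType) (d : nat)
    (mu : probability (lattice d) R) : Prop :=
  exists (eps : R) (N : 'rV[R]_d -> R),
    [/\ 0 < eps, is_norm N
      & (\int[mu]_(x in setT)
           (expR (N (lattice_to_real R x) `^ (1 + eps)))%:E < +oo)%E].

Definition harmonic_fun (R : realType) (d : nat)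
    (mu : probability (lattice d) R) (f : lattice d -> {nonneg R}) : Prop :=
  forall x0 : lattice d,
    ((f x0)%:num%:E = \int[mu]_(x in setT) (f (x0 + x))%:num%:E)%E.

(* Main.v *)
Require Import Defs.
From mathcomp Require Import all_boot all_order all_algebra.
From mathcomp Require Import all_classical all_reals all_analysis.
From mathcomp Require Import ring lra.
Import Order.TTheory GRing.Theory Num.Theory.
Import numFieldNormedType.Exports.

Set Implicit Arguments.
Unset Strict Implicit.
Unset Printing Implicit Defensive.

Local Open Scope classical_set_scope.
Local Open Scope ring_scope.

(** Fatou's lemma makes a pointwise limit [f] of non-negative harmonic
functions [F n] superharmonic.  The converse inequality can only fail if some
of the mass of [F n] with respect to [mu] escapes to infinity, and the proof
bounds that escape uniformly in [n].

On the cone of non-negative harmonic functions, every atom [s] of [mu] gives a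
Harnack inequality [mu{s} * f (x + s) <= f x].  Multiplying such inequalities
for atoms [s_1, ..., s_m] that span the support of [mu] over the reals gives
one for [s = s_1 + ... + s_m], with constant [c].  Put
[A f = x |-> c * f (x + s)] and [B = 1 - A]: both preserve the cone, so that
heuristically [A] is a multiplication by a number of [0, 1].  Two elementary
inequalities follow:
- [(k + 1) A B^k <= 1]: the function [B^k f], which is the part of [f] where
  [A] is small, satisfies [B^k f (0) <= f (- s) / (c (k + 1))];
- [1 - B^k <= k A]: what is left after [B^k f] is removed can be pushed by [s]
  at the cost of a factor [k].
Apply this with [k_j = K (j + 1) (j + 2)] for all [j].  The removed parts add
up to [q = \sum_j B^(k_j) f], whose integral is at most [f (- s) / (c K)]
(lemma [harmonic_residual]), and for every [J]
[f x <= q x + (\prod_(j < J) k_j) c^J f (x + J s)].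

If [x] is in the support of [mu], its real coordinates along the [s_i] are
[O(|x|)]; rounding them down shows that, for some [J = O(|x|)], the point
[x + J s] is [r + \sum_i p_i s_i] with natural numbers [p_i <= 2 J] and [r] in
a fixed finite box ([support_decomposition]).  By Harnack again
[c^(2 J) f (x + J s) <= f r].  Hence [f x] is at most [q x] plus a bound
[M] of [f] on the box times a factor [exp (O(|x| log |x|))].  That factor is at
most [D x = C' exp (|x|^(1 + eps))], which is integrable by the moment
assumption, so [f <= q + D * M] on the support ([uniform_tail_control]).

The limits of [F n] on the box and at [- s] are finite, so [M] and the bound
on the integral of [q] are uniform in [n], and the latter is arbitrarily small
with [1 / K].  Dominated convergence for [min (F n) (D * M)] then gives
[f 0 <= \int f], and translation gives the same inequality at all points. *)

(** * The cone of non-negative harmonic functions *)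

Section Cone.
Context (R : realType) (d : nat) (mu : probability (lattice d) R).
Implicit Types (f g : lattice d -> R) (s x : lattice d).

Lemma lattice_measurable_fun d' (Y : sigmaRingType d') (D : set (lattice d))
  (f : lattice d -> Y) : measurable_fun D f.
Proof. by []. Qed.

(** Real-valued, so that differences make sense; the integral keeps its extended
value, and its equation includes integrability. *)
Definition pos_harmonic f : Prop :=
  (forall x, 0 <= f x) /\
  forall x, (\int[mu]_y (f (x + y))%:E = (f x)%:E)%E.

Lemma pos_harmonic_ge0 f x : pos_harmonic f -> 0 <= f x.
Proof. by case. Qed.

Lemma pos_harmonic_integrable f x : pos_harmonic f ->
  mu.-integrable setT (fun y => (f (x + y))%:E).
Proof.
move=> [f0 fh]; apply/integrableP; split; first exact: lattice_measurable_fun.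
under eq_integral do rewrite /= ger0_norm//.
by rewrite fh ltry.
Qed.

Lemma pos_harmonic_shift f s : pos_harmonic f ->
  pos_harmonic (fun x => f (x + s)).
Proof.
move=> [f0 fh]; split=> // x; rewrite -fh.
by apply: eq_integral => y _; rewrite addrAC.
Qed.

Lemma pos_harmonicD f g : pos_harmonic f -> pos_harmonic g ->
  pos_harmonic (f + g).
Proof.
move=> hf hg; split=> [x|x].
  exact: addr_ge0 (pos_harmonic_ge0 x hf) (pos_harmonic_ge0 x hg).
under eq_integral do rewrite [(f + g) _]/(f _ + g _) EFinD.
rewrite integralD//.
- by case: hf => _ ->; case: hg => _ ->.
- exact: (pos_harmonic_integrable x hf).
- exact: (pos_harmonic_integrable x hg).
Qed.

Lemma pos_harmonicZ f (a : R) : 0 <= a -> pos_harmonic f ->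
  pos_harmonic (a *: f).
Proof.
move=> a0 hf; split=> [x|x]; first exact: mulr_ge0 (pos_harmonic_ge0 x hf).
under eq_integral do rewrite [(a *: f) _]/(a * f _) EFinM.
rewrite integralZl//; last exact: (pos_harmonic_integrable x hf).
by case: hf => _ ->.
Qed.

Lemma pos_harmonicB f g : pos_harmonic f -> pos_harmonic g ->
  (forall x, g x <= f x) -> pos_harmonic (f - g).
Proof.
move=> hf hg gf; split=> [x|x]; first by rewrite [leRHS]/(f x - g x) subr_ge0.
under eq_integral do rewrite [(f - g) _]/(f _ - g _) EFinB.
rewrite integralB//.
- by case: hf => _ ->; case: hg => _ ->.
- exact: (pos_harmonic_integrable x hf).
- exact: (pos_harmonic_integrable x hg).
Qed.

Lemma pos_harmonic0 : pos_harmonic 0.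
Proof. by split=> // x; rewrite integral0. Qed.

Lemma pos_harmonic_sum (I : Type) (r : seq I) (F : I -> lattice d -> R) :
  (forall i, pos_harmonic (F i)) -> pos_harmonic (\sum_(i <- r) F i).
Proof.
move=> hF; elim/big_ind: _ => //; first exact: pos_harmonic0.
exact: pos_harmonicD.
Qed.

(** A Harnack inequality in the direction [s], uniform over the whole cone. *)
Definition step_weight (s : lattice d) (c : R) : Prop :=
  0 < c /\ forall f, pos_harmonic f -> forall x, c * f (x + s) <= f x.

Lemma step_weight0 : step_weight 0 1.
Proof. by split=> // f _ x; rewrite mul1r addr0. Qed.

Lemma step_weightD s t a b : step_weight s a -> step_weight t b ->
  step_weight (s + t) (a * b).
Proof.
move=> [a0 sa] [b0 tb]; split=> [|f hf x]; first exact: mulr_gt0.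
apply: le_trans (sa f hf x); rewrite -mulrA ler_pM2l// addrA.
exact: tb.
Qed.

Lemma step_weightMn s a n : step_weight s a -> step_weight (s *+ n) (a ^+ n).
Proof.
move=> sa; elim: n => [|n ih]; first by rewrite mulr0n expr0; exact: step_weight0.
by rewrite mulrS exprS; exact: step_weightD.
Qed.

Lemma step_weight_sum (I : Type) (r : seq I) (s : I -> lattice d) (a : I -> R) :
  (forall i, step_weight (s i) (a i)) ->
  step_weight (\sum_(i <- r) s i) (\prod_(i <- r) a i).
Proof.
move=> sa; elim: r => [|i r ih]; first by rewrite !big_nil; exact: step_weight0.
by rewrite !big_cons; exact: step_weightD.
Qed.

(** The term [y = s] of the integral [\int f (x + y)] is at most the whole. *)
Lemma step_weight_atom s : (0 < mu [set s])%E ->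
  step_weight s (fine (mu [set s])).
Proof.
move=> mus0; have mfin : mu [set s] \is a fin_num by exact: fin_num_measure.
split=> [|f hf x]; first by rewrite -lte_fin fineK.
rewrite -lee_fin EFinM fineK//; case: (hf) => f0 /(_ x) <-.
have -> : (mu [set s] * (f (x + s))%:E
  = \int[mu]_y ((f (x + s))%:E * (\1_[set s] y)%:E))%E.
  rewrite ge0_integralZl_EFin//.
  by rewrite integral_indic// setIT muleC.
apply: ge0_le_integral => // y _; rewrite -EFinM lee_fin ?mulr_ge0//.
rewrite indicE; case: (boolP (y \in [set s])) => [|_]; last by rewrite mulr0.
by rewrite inE /= => ->; rewrite mulr1.
Qed.

(** The lattice is countable, so the points of measure zero form a null set. *)
Lemma ae_atom : {ae mu, forall x, (0 < mu [set x])%E}.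
Proof.
apply: (@negligibleS _ _ _ mu
  (\bigcup_k (if pickle_inv k is Some x
     then [set x : 'rV[int]_d | mu [set x] = 0%E] `&` [set x] else set0))).
  move=> x /=; rewrite lt0e measure_ge0 andbT => /negP; rewrite negbK => /eqP mx.
  by exists (pickle (x : 'rV[int]_d)) => //; rewrite pickleK_inv; split.
apply: negligible_bigcup => k; case: pickle_inv => [x|]; last exact: negligible_set0.
have [mx|mx] := pselect (mu [set x] = 0%E).
  by exists [set x]; split=> // y [].
by exists set0; split=> // y [/= + yx]; rewrite yx.
Qed.

End Cone.

(** * Splitting a harmonic function along one direction *)

Section Thinning.
Context (R : realType) (d : nat) (mu : probability (lattice d) R).
Local Notation fct := (lattice d -> R).
Local Notation pos_harmonic := (pos_harmonic mu).
Implicit Types (f g : fct) (T U : fct -> fct).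

(** An order version of multiplication by a function with values in [0, 1]: with
[f <= g] meaning that [g - f] is in the cone, [0 <= T <= 1]. *)
Definition contraction T : Prop :=
  (forall f g, T (f - g) = T f - T g) /\
  forall f, pos_harmonic f -> pos_harmonic (T f) /\ pos_harmonic (f - T f).

Lemma contraction_id : contraction id.
Proof. by split=> // f hf; split=> //; rewrite subrr; exact: pos_harmonic0. Qed.

Lemma contraction_comp T U : contraction T -> contraction U ->
  contraction (T \o U).
Proof.
move=> [Tsub hT] [Usub hU]; split=> [f g|f hf] /=; first by rewrite Usub Tsub.
have [hUf hfU] := hU f hf; have [hTU hUT] := hT _ hUf; split=> //.
by rewrite -(subrKA (U f)); exact: pos_harmonicD.
Qed.

Lemma contraction_iter T n : contraction T -> contraction (iter n T).
Proof.
move=> hT; elim: n => [|n ih]; first exact: contraction_id.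
exact: contraction_comp.
Qed.

Lemma contraction_compl T : contraction T -> contraction (fun f => f - T f).
Proof.
move=> [Tsub hT]; split=> [f g|f hf]; first by rewrite Tsub !opprD !opprK addrACA.
by have [hTf hfT] := hT f hf; split=> //; rewrite subKr.
Qed.

(** The product of the operators [1 - T j] for [j < J]. *)
Fixpoint thin (T : nat -> fct -> fct) (J : nat) f : fct :=
  if J is J'.+1 then thin T J' f - T J' (thin T J' f) else f.

Lemma contraction_thin (T : nat -> fct -> fct) J :
  (forall j, contraction (T j)) -> contraction (thin T J).
Proof.
move=> hT; elim: J => [|J ih]; first exact: contraction_id.
exact: (contraction_comp (contraction_compl (hT J)) ih).
Qed.

(** The union bound [1 - \prod_j (1 - T j) <= \sum_j T j], in the order of the cone.
The operators need not commute: the increment [T J (thin T J f)] is at most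
[T J f] because [thin T J f <= f]. *)
Lemma thin_union_bound (T : nat -> fct -> fct) J f :
  (forall j, contraction (T j)) -> pos_harmonic f ->
  pos_harmonic (\sum_(j < J) T j f - (f - thin T J f)).
Proof.
move=> hT hf; elim: J => [|J ih].
  by rewrite big_ord0 /= subrr subr0; exact: pos_harmonic0.
rewrite big_ord_recr /=.
have -> : \sum_(j < J) T j f + T J f - (f - (thin T J f - T J (thin T J f)))
    = (\sum_(j < J) T j f - (f - thin T J f)) + T J (f - thin T J f).
  by rewrite (hT J).1; ring.
apply: pos_harmonicD => //.
have [_ hfJ] := (contraction_thin J hT).2 f hf.
by have [] := (hT J).2 _ hfJ.
Qed.

Variables (s : lattice d) (c : R).
Hypothesis wsc : step_weight mu s c.

Definition step f : fct := fun x => c * f (x + s).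

Definition unstep f : fct := f - step f.

Lemma stepB f g : step (f - g) = step f - step g.
Proof. by apply/funext => x; exact: mulrBr. Qed.

Lemma stepZ a f : step (a *: f) = a *: step f.
Proof. by apply/funext => x; exact: mulrCA. Qed.

Lemma iter_stepE J f x : iter J step f x = c ^+ J * f (x + s *+ J).
Proof.
elim: J x => [|J ih] x; first by rewrite mul1r addr0.
by rewrite iterS /step ih mulrA -exprS mulrS addrA.
Qed.

Lemma contraction_step : contraction step.
Proof.
split=> [|f hf]; first exact: stepB.
have hs : pos_harmonic (step f).
  apply: (@pos_harmonicZ _ _ _ (fun x => f (x + s))); first exact: ltW wsc.1.
  exact: pos_harmonic_shift.
by split=> //; apply: pos_harmonicB => // x; exact: wsc.2.
Qed.

Lemma contraction_unstep k : contraction (iter k unstep).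
Proof. exact/contraction_iter/contraction_compl/contraction_step. Qed.

Lemma step_pos_harmonic f : pos_harmonic f -> pos_harmonic (step f).
Proof. by move=> hf; have [] := contraction_step.2 f hf. Qed.

Lemma unstep_telescope k f :
  f - iter k unstep f = \sum_(l < k) step (iter l unstep f).
Proof.
elim: k => [|k ih]; first by rewrite big_ord0 subrr.
by rewrite big_ord_recr /= -ih [in LHS]/unstep opprB addrA addrAC.
Qed.

(** Bernoulli's inequality [1 - (1 - A)^k <= k A], from the telescoping sum of the
functions [A B^l f], each of which is at most [A f]. *)
Lemma unstep_compl_le k f : pos_harmonic f ->
  pos_harmonic (k%:R *: step f - (f - iter k unstep f)).
Proof.
move=> hf; rewrite unstep_telescope.
have -> : k%:R *: step f - \sum_(l < k) step (iter l unstep f)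
    = \sum_(l < k) step (f - iter l unstep f).
  under [RHS]eq_bigr do rewrite stepB.
  by rewrite sumrB sumr_const card_ord scaler_nat.
apply: pos_harmonic_sum => l; apply: step_pos_harmonic.
by have [] := (contraction_unstep l).2 f hf.
Qed.

(** [(k + 1) A (1 - A)^k <= 1]: the functions [A B^l f] for [l <= k] decrease with
[l] and sum up to at most [f]. *)
Lemma step_unstep_le k f : pos_harmonic f ->
  pos_harmonic (f - k.+1%:R *: step (iter k unstep f)).
Proof.
move=> hf.
have -> : f - k.+1%:R *: step (iter k unstep f) = iter k.+1 unstep f
    + \sum_(l < k.+1) step (iter l unstep f - iter k unstep f).
  under eq_bigr do rewrite stepB.
  rewrite sumrB sumr_const card_ord scaler_nat -unstep_telescope.
  by rewrite addrA addrCA subrr addr0.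
apply: pos_harmonicD; first by have [] := (contraction_unstep k.+1).2 f hf.
apply: pos_harmonic_sum => -[l /= lk]; apply: step_pos_harmonic.
rewrite ltnS in lk; rewrite -(subnK lk).
rewrite iterD; have [hl _] := (contraction_unstep l).2 f hf.
by have [] := (contraction_unstep (k - l)).2 _ hl.
Qed.

(** [step_unstep_le] evaluated at [x - s], where [A] reads the value at [x]. *)
Lemma iter_unstep_le k f x : pos_harmonic f ->
  iter k unstep f x <= (c * k.+1%:R)^-1 * f (x - s).
Proof.
move=> hf.
have : 0 <= f (x - s) - k.+1%:R * (c * iter k unstep f (x - s + s)).
  exact: pos_harmonic_ge0 (x - s) (step_unstep_le k hf).
rewrite subrK subr_ge0 mulrA (mulrC k.+1%:R) => h.
by rewrite mulrC ler_pdivlMr ?mulr_gt0 ?wsc.1// mulrC.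
Qed.

Variable k : nat -> nat.

(** Each factor [1 - B^(k j)] of [thin] is at most [k j] times [A]. *)
Lemma thin_le J f : pos_harmonic f ->
  pos_harmonic ((\prod_(j < J) (k j)%:R) *: iter J step f
    - thin (fun j => iter (k j) unstep) J f).
Proof.
move=> hf; elim: J => [|J ih].
  by rewrite big_ord0 /= scale1r subrr; exact: pos_harmonic0.
rewrite big_ord_recr /=; set g := thin _ J f; set P := \prod_(j < J) _.
have hg : pos_harmonic g.
  by have [] := (contraction_thin J (fun j => contraction_unstep (k j))).2 f hf.
have -> : (P * (k J)%:R) *: step (iter J step f) - (g - iter (k J) unstep g)
  = (k J)%:R *: step (P *: iter J step f - g)
    + ((k J)%:R *: step g - (g - iter (k J) unstep g)).
  by rewrite (mulrC P) -scalerA stepB stepZ scalerBr subrKA.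
apply: pos_harmonicD; last exact: unstep_compl_le.
exact/pos_harmonicZ/step_pos_harmonic.
Qed.

Lemma pos_harmonic_split J f x : pos_harmonic f ->
  f x <= \sum_(j < J) iter (k j) unstep f x
         + (\prod_(j < J) (k j)%:R) * c ^+ J * f (x + s *+ J).
Proof.
move=> hf.
set g := thin (fun j => iter (k j) unstep) J f.
have : 0 <= (\sum_(j < J) iter (k j) unstep f) x - (f x - g x).
  have hT j : contraction (iter (k j) unstep) by exact: contraction_unstep.
  exact: pos_harmonic_ge0 x (thin_union_bound J hT hf).
have : 0 <= \prod_(j < J) (k j)%:R * iter J step f x - g x.
  exact: pos_harmonic_ge0 x (thin_le J hf).
by rewrite iter_stepE fct_sumE mulrA; lra.
Qed.

End Thinning.

Section Residual.
Context (R : realType) (d : nat) (mu : probability (lattice d) R).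
Local Notation pos_harmonic := (pos_harmonic mu).

Lemma pos_harmonic_int f : pos_harmonic f -> (\int[mu]_y (f y)%:E = (f 0)%:E)%E.
Proof. by case=> _ /(_ 0) <-; under [RHS]eq_integral do rewrite add0r. Qed.

(** The exponents [K (j + 1) (j + 2)] below are chosen for this telescoping sum. *)
Lemma sum_pronic_inv n :
  \sum_(0 <= j < n) ((j.+1 * j.+2)%:R : R)^-1 = 1 - n.+1%:R^-1.
Proof.
elim: n => [|n ih]; first by rewrite big_nil invr1 subrr.
rewrite big_nat_recr//= ih natrM.
have h1 : (n.+1%:R : R) != 0 by rewrite pnatr_eq0.
have h2 : (n.+2%:R : R) != 0 by rewrite pnatr_eq0.
rewrite invfM -[n.+2%:R]natr1 in h2 *.
by field; apply/andP.
Qed.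

(** The residual [q] sums the parts of [f] on which the step operator is small; it
is the same for all [J], which is what allows [J] to depend on [x] later.  Its
integral is computed term by term, every term being harmonic. *)
Lemma harmonic_residual s c (K : nat) (f : lattice d -> R) :
  step_weight mu s c -> (0 < K)%N -> pos_harmonic f ->
  exists q : lattice d -> \bar R, [/\ forall x, (0 <= q x)%E,
    (\int[mu]_x q x <= ((c * K%:R)^-1 * f (- s))%:E)%E &
    forall J x, ((f x)%:E <=
      q x + ((K%:R * c * J.+1%:R ^+ 2) ^+ J * f (x + s *+ J))%:E)%E].
Proof.
move=> wsc K0 hf; have c0 := wsc.1.
pose k j := (K * (j.+1 * j.+2))%N.
pose b j := iter (k j) (unstep s c) f.
have hb j : pos_harmonic (b j) by have [] := (contraction_unstep wsc (k j)).2 f hf.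
have b0 j x : 0 <= b j x by exact: pos_harmonic_ge0 x (hb j).
exists (fun x => \sum_(0 <= j <oo) (b j x)%:E)%E; split=> [x||J x].
- by apply: nneseries_ge0 => j _ _; rewrite lee_fin.
- rewrite integral_nneseries//; last by move=> j x _; rewrite lee_fin.
  apply: lime_le.
    by apply: is_cvg_nneseries => j _ _; apply: integral_ge0 => x _; rewrite lee_fin.
  apply: nearW => n.
  under eq_bigr do rewrite (pos_harmonic_int (hb _)).
  rewrite sumEFin lee_fin.
  apply: (@le_trans _ _ ((c * K%:R)^-1 * f (- s)
      * \sum_(0 <= j < n) ((j.+1 * j.+2)%:R)^-1)).
    rewrite mulr_sumr; apply: ler_sum => j _.
    apply: le_trans (iter_unstep_le wsc (k j) 0 hf) _; rewrite sub0r.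
    rewrite mulrAC ler_wpM2r ?(pos_harmonic_ge0 _ hf)// -invfM.
    rewrite lef_pV2 ?posrE ?mulr_gt0 ?ltr0n//.
    by rewrite -mulrA ler_pM2l// -natrM ler_nat leqnSn.
  rewrite ler_piMr//.
    by rewrite mulr_ge0 ?(pos_harmonic_ge0 _ hf)// invr_ge0 mulr_ge0// ltW.
  by rewrite sum_pronic_inv lerBlDr lerDl invr_ge0.
- have bJ : (\sum_(0 <= j < J) (b j x)%:E <= \sum_(0 <= j <oo) (b j x)%:E)%E.
    by apply: nneseries_lim_ge => j _ _; rewrite lee_fin.
  apply: le_trans (leeD2r _ bJ); rewrite sumEFin -EFinD lee_fin.
  rewrite big_mkord; apply: le_trans (pos_harmonic_split wsc k J x hf) _.
  rewrite lerD2l ler_wpM2r ?(pos_harmonic_ge0 _ hf)//.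
  rewrite mulrAC exprMn ler_wpM2r ?exprn_ge0 ?(ltW c0)//.
  rewrite -[X in _ ^+ X]card_ord -prodr_const; apply: ler_prod => j _.
  rewrite ler0n -natrX -natrM ler_nat leq_mul2l expnS expn1.
  by apply/orP; right; apply: leq_mul; rewrite ltnS// ltnW.
Qed.

End Residual.

(** * Super-exponential growth *)

Section Growth.
Context (R : realType).

(** [exp y >= (y / n)^n] with [n * eps >= 3]. *)
Lemma expR_ge_powR_cube (a eps : R) : 0 < a -> 0 < eps ->
  exists2 g : R, 0 < g & forall t, 1 <= t -> g * t ^+ 3 <= expR (a * t `^ eps).
Proof.
move=> a0 e0; pose n := (Num.truncn (3 / eps)).+1.
have n0 : 0 < n%:R :> R by rewrite ltr0n.
exists ((a / n%:R) ^+ n); first by rewrite exprn_gt0// divr_gt0.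
move=> t t1; have t0 : 0 <= t by apply: le_trans t1.
have -> : a * t `^ eps = n%:R * (a / n%:R * t `^ eps).
  by field; rewrite gt_eqF.
rewrite expRM_natl; apply: (@le_trans _ _ ((a / n%:R * t `^ eps) ^+ n)).
  rewrite [leRHS]exprMn ler_wpM2l ?exprn_ge0 ?divr_ge0 ?(ltW a0)//.
  rewrite -!powR_mulrn ?powR_ge0// -powRrM; apply: ler_powR => //.
  by rewrite mulrC -ler_pdivrMr// ltW// truncnS_gt.
rewrite lerXn2r ?nnegrE ?expR_ge0 ?mulr_ge0 ?powR_ge0 ?divr_ge0 ?(ltW a0)//.
by apply: le_trans (expR_ge1Dx _); rewrite lerDr.
Qed.

(** The left-hand side is [exp (O(t log t))].  It is a [J]-th power, as is
[expR (J * (a * J.+1 ^ eps))], a lower bound of the right-hand side for some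
[a > 0]; for large [J] it suffices to compare the bases, a quadratic and an
exponential of a power of [J.+1]. *)
Lemma superexp_growth (G C eps : R) : 0 < eps ->
  exists2 C' : R, 0 <= C' &
  forall (t : R) (J : nat), 0 <= t -> J%:R <= C * (t + 1) ->
  (G * J.+1%:R ^+ 2) ^+ J <= C' * expR (t `^ (1 + eps)).
Proof.
move=> eps0; pose C1 := Num.max 1 C; pose G1 := Num.max 1 `|G|.
have C1_ge1 : 1 <= C1 by rewrite le_max lexx.
have C1_gt0 : 0 < C1 by apply: lt_le_trans C1_ge1.
have G1_ge1 : 1 <= G1 by rewrite le_max lexx.
(* [J.+1 <= 2 * C1 * (t + 1) <= t / beta] as soon as [1 <= t] *)
pose beta : R := (4 * C1)^-1.
have beta0 : 0 < beta by rewrite invr_gt0 mulr_gt0.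
have gamma0 : 0 < beta * beta `^ eps by rewrite mulr_gt0// powR_gt0.
have [g g0 hg] := expR_ge_powR_cube gamma0 eps0.
(* below [m] there are finitely many [J], absorbed in the constant [C'] *)
pose m := (Num.truncn (Num.max (4 * C1) (G1 / g))).+1.
exists ((G1 * m%:R ^+ 2) ^+ m).
  by rewrite exprn_ge0// mulr_ge0// (le_trans ler01).
move=> t J t0 Jt.
have Jt1 : J.+1%:R <= 2 * C1 * (t + 1).
  have : J%:R <= C1 * (t + 1).
    by apply: le_trans Jt _; rewrite ler_wpM2r ?addr_ge0// le_max lexx orbT.
  have : 1 <= C1 * (t + 1) by rewrite -[leLHS]mulr1 ler_pM// lerDr.
  by rewrite -natr1; lra.
have GJ0 : 0 <= G1 * J.+1%:R ^+ 2.
  by rewrite mulr_ge0// ?exprn_ge0// (le_trans ler01).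
apply: (@le_trans _ _ ((G1 * J.+1%:R ^+ 2) ^+ J)).
  apply: le_trans (ler_norm _) _; rewrite normrX lerXn2r ?nnegrE//.
  by rewrite normrM normrX normr_nat ler_wpM2r ?exprn_ge0// le_max lexx orbT.
have [Jm|mJ] := ltnP J m.
  rewrite -[leLHS]mulr1 ler_pM ?exprn_ge0//; last first.
    by rewrite -expR0 ler_expR powR_ge0.
  apply: (@le_trans _ _ ((G1 * m%:R ^+ 2) ^+ J)).
    rewrite lerXn2r ?nnegrE//; first by rewrite mulr_ge0// (le_trans ler01).
    by rewrite ler_wpM2l ?(le_trans ler01)// lerXn2r ?nnegrE// ler_nat.
  apply: ler_weXn2l; last exact: ltnW.
  rewrite -[leLHS]mulr1 ler_pM//.
  by rewrite exprn_ege1// ler1n.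
have [C1J gJ] : 4 * C1 < J%:R /\ G1 / g < J%:R.
  apply/andP; rewrite -gt_max -truncn_lt_nat//.
  by rewrite le_max mulr_ge0// ltW.
have t1 : 1 <= t.
  rewrite leNgt; apply/negP => t1.
  have : C1 * (t + 1) < C1 * 2 by rewrite ltr_pM2l//; lra.
  by move: Jt1; rewrite -natr1; lra.
have Jb : J.+1%:R * beta <= t.
  rewrite ler_pdivrMr ?mulr_gt0//; apply: le_trans Jt1 _.
  have -> : t * (4 * C1) = 2 * C1 * (t + t) by ring.
  by rewrite ler_pM2l ?mulr_gt0// lerD2l.
have J1 : 1 <= J.+1%:R :> R by rewrite ler1n.
rewrite -[leLHS]mul1r; apply: ler_pM => //.
- by rewrite exprn_ge0.
- rewrite exprn_ege1// -[leLHS]mulr1 ler_pM//.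
  by rewrite exprn_ege1// ler1n.
apply: (@le_trans _ _ (expR (beta * beta `^ eps * J.+1%:R `^ eps) ^+ J)).
  rewrite lerXn2r ?nnegrE ?expR_ge0//; apply: le_trans (hg _ J1).
  rewrite [_ ^+ 3]exprS [leRHS]mulrA ler_wpM2r ?exprn_ge0//.
  rewrite -ler_pdivrMl// mulrC; apply: ltW; apply: lt_le_trans gJ _.
  by rewrite ler_nat.
rewrite -expRM_natl ler_expR.
rewrite powRD ?powRr1//; last first.
  by apply/implyP => _; rewrite gt_eqF// (lt_le_trans ltr01).
rewrite -(mulrA beta) mulrA -powRM ?(ltW beta0)//.
apply: ler_pM; rewrite ?powR_ge0 ?mulr_ge0 ?(ltW beta0)//.
  by apply: le_trans Jb; rewrite ler_wpM2r ?(ltW beta0)// ler_nat.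
by rewrite ge0_ler_powR ?nnegrE ?mulr_ge0 ?(ltW eps0) ?(ltW beta0)// mulrC.
Qed.
End Growth.

(** * Norms and spanning families *)

Section Norm.
Context (R : realType) (d : nat) (N : 'rV[R]_d -> R).
Hypothesis normN : is_norm N.

Lemma is_norm_sum (I : Type) (r : seq I) (F : I -> 'rV[R]_d) :
  N (\sum_(i <- r) F i) <= \sum_(i <- r) N (F i).
Proof.
have [_ _ NZ ND] := normN.
elim: r => [|i r ih]; first by rewrite !big_nil -(scale0r 0) NZ normr0 mul0r.
by rewrite !big_cons; apply: le_trans (ND _ _) _; rewrite lerD2l.
Qed.

Lemma coord_le_mx_norm (v : 'rV[R]_d) i : `|v 0 i| <= `|v|.
Proof.
rewrite [leRHS]/Num.norm /= mx_normrE.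
by apply: (le_bigmax _ (fun ij : 'I_1 * 'I_d => `|v ij.1 ij.2|) (0, i)).
Qed.

Lemma is_norm_le_mx_norm : exists2 L, 0 <= L & forall v, N v <= L * `|v|.
Proof.
have [N0 _ NZ _] := normN.
exists (\sum_i N (delta_mx 0 i)); first exact: sumr_ge0.
move=> v; rewrite {1}[v]row_sum_delta; apply: le_trans (is_norm_sum _ _) _.
rewrite mulr_suml; apply: ler_sum => i _.
by rewrite NZ mulrC ler_wpM2l// coord_le_mx_norm.
Qed.

Lemma is_norm_continuous : continuous N.
Proof.
have [_ _ _ ND] := normN; have [L L0 NL] := is_norm_le_mx_norm.
have sub v w : N v - N w <= L * `|v - w|.
  by apply: le_trans (NL _); rewrite lerBlDr -{1}(subrK w v).
move=> v.
apply: (proj2 (@cvgrPdist_le _ _ _ (nbhs v) (nbhs_filter v) N (N v))) => e e0.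
near=> w.
have vw : L * `|v - w| <= e.
  rewrite mulrC; apply: le_trans (_ : `|v - w| * (L + 1) <= _).
    by rewrite ler_wpM2l// lerDl.
  rewrite -ler_pdivlMr ?ltr_wpDl//.
  near: w.
  apply: (proj1 (@cvgrPdist_le _ _ _ (nbhs v) (nbhs_filter v) id v)) => //.
  by rewrite divr_gt0// ltr_wpDl.
rewrite ler_norml (le_trans (sub v w))// andbT lerNl opprB.
by rewrite (le_trans (sub w v))// distrC.
Unshelve. all: by end_near. Qed.

(** The norm reaches a positive minimum on the compact unit sphere. *)
Lemma mx_norm_le_is_norm : exists2 C, 0 <= C & forall v, `|v| <= C * N v.
Proof.
have [N0 N_eq0 NZ _] := normN.
pose S := [set v : 'rV[R]_d | `|v| = 1].
have [S0|/set0P S0] := eqVneq S set0.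
  exists 0 => // v; rewrite mul0r normr_le0; apply/negPn/negP => v0.
  have : S (`|v|^-1 *: v) by rewrite /S /= normrZ normfV normr_id mulVf// normr_eq0.
  by rewrite S0.
have cS : compact S.
  apply: bounded_closed_compact.
    by exists 1; split=> // M M1 v /= ->; exact: ltW.
  rewrite (_ : S = (@Num.norm _ _) @^-1` [set 1])//.
  apply: closed_comp => [v _|]; [exact: norm_continuous|exact: closed_eq].
have [v0 v0S v0min] := EVT_min_rV S0 cS (continuous_subspaceT is_norm_continuous).
have Nv0 : 0 < N v0.
  rewrite lt0r N0 andbT; apply/eqP => /N_eq0 v00.
  by move: v0S; rewrite v00 inE /S /= normr0 => /eqP; rewrite eq_sym oner_eq0.
exists (N v0)^-1; first by rewrite invr_ge0.
move=> v; have [->|vn0] := eqVneq v 0; first by rewrite normr0 mulr_ge0// invr_ge0.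
have nv0 : 0 < `|v| by rewrite normr_gt0.
have := v0min (`|v|^-1 *: v); rewrite inE NZ normfV normr_id => vmin.
rewrite mulrC ler_pdivlMr// mulrC -ler_pdivlMr// mulrC; apply: vmin.
by rewrite /S /= normrZ normfV normr_id mulVf// normr_eq0.
Qed.

End Norm.

(** A family of maximal rank spans; the bound [d] on the rank makes one exist. *)
Lemma finite_spanning_family (F : fieldType) (d : nat) (T : Type)
    (P : T -> Prop) (v : T -> 'rV[F]_d) :
  exists m (s : 'I_m -> T), (forall i, P (s i)) /\
    forall x, P x -> (v x <= \matrix_(i < m) v (s i))%MS.
Proof.
pose Q r := `[< exists m (s : 'I_m -> T), (forall i, P (s i)) /\
  \rank (\matrix_(i < m) v (s i)) = r >].
have exQ : exists r, Q r.
  exists (\rank (\matrix_(i < 0) (0 : 'rV[F]_d))); apply/asboolP.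
  have s0 : 'I_0 -> T by case.
  exists 0, s0; split=> [[]//|]; congr (\rank _).
  by apply/matrixP => -[].
have ubQ r : Q r -> (r <= d)%N.
  by move=> /asboolP[m [s [_ <-]]]; exact: rank_leq_col.
case: (ex_maxnP exQ ubQ) => r /asboolP[m [s [Ps rs]]] rmax.
exists m, s; split=> // x Px; apply/negPn/negP => xs.
pose s' (i : 'I_(1 + m)) := if fintype.split i is inr j then s j else x.
have s'E : \matrix_(i < 1 + m) v (s' i) = col_mx (v x) (\matrix_(i < m) v (s i)).
  apply/row_matrixP => i; rewrite rowK /s'; case: split_ordP => j ->.
    by rewrite rowKu (ord1 j) row_id.
  by rewrite rowKd rowK.
have /rmax : Q (\rank (\matrix_(i < 1 + m) v (s' i))).
  apply/asboolP; exists (1 + m)%N, s'; split=> // i.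
  by rewrite /s'; case: fintype.split.
rewrite leqNgt -rs s'E => /negP; apply; apply: rank_ltmx.
rewrite /ltmx; apply/andP; split; first by rewrite -addsmxE addsmxSr.
apply: contra xs; apply: submx_trans; by rewrite -addsmxE addsmxSl.
Qed.

(** * Writing the support along finitely many steps *)

Section Geometry.
Context (R : realType) (d : nat).
Local Notation toR := (@lattice_to_real R d).

Lemma lattice_to_realB (x y : lattice d) : toR (x - y) = toR x - toR y.
Proof. exact: (map_mxB (intr : int -> R)). Qed.

Lemma lattice_to_real_sumz (I : finType) (s : I -> lattice d) (n : I -> int) :
  toR (\sum_i s i *~ n i) = \sum_i (n i)%:~R *: toR (s i).
Proof.
pose f : {additive _ -> _} := @map_mx _ _ (intr : int -> R) 1 d.
rewrite -[LHS]/(f _) (raddf_sum f).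
by apply: eq_bigr => i _; rewrite (raddfMz f) scaler_int.
Qed.

(** With [c i] the real coordinates of [x] along [s i], the remainder [r] collects
the fractional parts of the [c i], so it stays in a fixed box, and [p i] is
[floor (c i) + J].  Adding [J] copies of every [s i] makes all [p i]
non-negative, as [J] exceeds every coordinate. *)
Lemma support_decomposition (N : 'rV[R]_d -> R)
    (P : lattice d -> Prop) : is_norm N ->
  exists m (s : 'I_m -> lattice d) (C : R) (b : nat),
    [/\ forall i, P (s i), 0 <= C &
    forall x (J : nat), P x -> C * (N (toR x) + 1) <= J%:R ->
      exists (r : lattice d) (p : 'I_m -> nat),
      [/\ x + (\sum_i s i) *+ J = r + \sum_i s i *+ p i,
          forall i, (p i <= 2 * J)%N & forall j, `|r 0 j| <= b%:Z]].
Proof.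
move=> normN; have [N0 _ _ _] := normN.
have [C1 C10 NC1] := mx_norm_le_is_norm normN.
have [m [s [Ps span]]] := finite_spanning_family P toR.
pose B := \matrix_(i < m) toR (s i).
pose C2 := \sum_i \sum_j `|pinvmx B j i|.
have C20 : 0 <= C2 by apply: sumr_ge0 => i _; apply: sumr_ge0.
pose b := Num.bound (\sum_i \sum_j `|B i j|).
exists m, s, (1 + C1 * C2), b; split=> //.
  by rewrite addr_ge0// mulr_ge0.
move=> x J Px CJ.
pose c := toR x *m pinvmx B; pose n i := Num.floor (c 0 i).
have cB : toR x = \sum_i c 0 i *: toR (s i).
  rewrite -[LHS](mulmxKpV (span x Px)) mulmx_sum_row.
  by apply: eq_bigr => i _; rewrite rowK.
have cle i : `|c 0 i| <= C1 * C2 * N (toR x).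
  rewrite mxE; apply: le_trans (ler_norm_sum _ _ _) _.
  apply: (@le_trans _ _ (\sum_j (C1 * N (toR x)) * `|pinvmx B j i|)).
    apply: ler_sum => j _; rewrite normrM ler_wpM2r//.
    exact: le_trans (coord_le_mx_norm _ _) (NC1 _).
  rewrite -mulr_sumr [leRHS]mulrAC ler_wpM2l ?mulr_ge0//.
  rewrite /C2 (bigD1 i)//= lerDl sumr_ge0// => k _; exact: sumr_ge0.
have nJ i : `|n i| <= J%:Z.
  rewrite -(ler_int R) intr_norm; apply: le_trans CJ.
  have /andP[nl nr] := floor_itv (c 0 i); move: (cle i); rewrite intrD in nr.
  have := N0 (toR x); have : 0 <= C1 * C2 * N (toR x) by rewrite !mulr_ge0.
  rewrite -/(n i) in nl nr *.
  have := mulr_ge0 C10 C20.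
  rewrite !ler_norml; nra.
have nJ0 i : 0 <= n i + J%:Z.
  by have := nJ i; rewrite ler_norml => /andP[+ _]; rewrite -subr_ge0 opprK.
(* the sum of the fractional parts of the coordinates *)
pose r := x - \sum_i s i *~ n i.
have rE : toR r = \sum_i (c 0 i - (n i)%:~R) *: toR (s i).
  rewrite lattice_to_realB lattice_to_real_sumz cB -sumrB.
  by apply: eq_bigr => i _; rewrite scalerBl.
exists r, (fun i => absz (n i + J%:Z)); split.
- rewrite /r -addrA; congr (_ + _); rewrite -sumrMnl addrC -sumrB.
  apply: eq_bigr => i _; rewrite [X in X - _]pmulrn.
  by rewrite gez0_abs// mulrzDr addrAC subrr add0r.
- move=> i; rewrite -lez_nat gez0_abs// mul2n -addnn PoszD lerD2r.
  by have := nJ i; rewrite ler_norml => /andP[].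
- move=> j; rewrite -(ler_int R) intr_norm.
  have -> : (r 0 j)%:~R = toR r 0 j :> R by rewrite [RHS]mxE.
  rewrite rE summxE.
  apply: (@le_trans _ _ (\sum_i \sum_j `|B i j|)); last first.
    by rewrite ltW// archi_boundP// sumr_ge0// => i _; exact: sumr_ge0.
  apply: le_trans (ler_norm_sum _ _ _) _; apply: ler_sum => i _.
  apply: (@le_trans _ _ `|B i j|).
    rewrite [B i j]mxE; set a := c 0 i - _; rewrite mxE normrM ler_piMl//.
    rewrite /a.
    have /andP[nl nr] := floor_itv (c 0 i); rewrite -/(n i) intrD in nl nr.
    by rewrite ger0_norm ?subr_ge0// lerBlDr addrC ltW.
  by rewrite (bigD1 j)//= lerDl sumr_ge0.
Qed.
End Geometry.

(** * Uniform integrability and the limit *)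

Section Control.
Context (R : realType) (d : nat) (mu : probability (lattice d) R).
Local Notation pos_harmonic := (pos_harmonic mu).
Local Notation toR := (@lattice_to_real R d).

(** Over the integer points of the sup-norm ball of radius [b]; a sum instead of a
maximum, because it passes to pointwise limits at once. *)
Definition box_sum (b : nat) (f : lattice d -> R) : R :=
  \sum_(v : 'rV['I_(b + b).+1]_d) f (\row_j ((v 0 j)%:Z - b%:Z)).

Lemma le_box_sum b (f : lattice d -> R) (r : lattice d) :
  (forall x, 0 <= f x) -> (forall j, `|r 0 j| <= b%:Z) -> f r <= box_sum b f.
Proof.
move=> f0 rb.
pose v : 'rV['I_(b + b).+1]_d := \row_j inord (absz (r 0 j + b%:Z)).
have rE : r = \row_j ((v 0 j)%:Z - b%:Z).
  apply/rowP => j; rewrite !mxE; have := rb j; rewrite ler_norml => /andP[r1 r2].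
  have rb0 : 0 <= r 0 j + b%:Z by rewrite -lerBlDr sub0r.
  rewrite inordK; first by rewrite gez0_abs// addrK.
  by rewrite ltnS -lez_nat gez0_abs// PoszD lerD2r.
by rewrite rE /box_sum (bigD1 v)//= lerDl sumr_ge0.
Qed.

(** [q] has a small integral when [K] is large, and [D] does not depend on [f]: this
is uniform integrability of the functions of the cone that are bounded on the
box and at [- s]. *)
Lemma uniform_tail_control : finite_superexp_moment mu ->
  exists (b : nat) (s : lattice d) (c : R), 0 < c /\
  forall K : nat, (0 < K)%N -> exists D : lattice d -> R,
  [/\ forall x, 0 <= D x, mu.-integrable setT (EFin \o D) &
  forall f, pos_harmonic f -> exists q : lattice d -> \bar R,
  [/\ forall x, (0 <= q x)%E,
      (\int[mu]_x q x <= ((c * K%:R)^-1 * f (- s))%:E)%E &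
      forall x, (0 < mu [set x])%E ->
        ((f x)%:E <= q x + (D x * box_sum b f)%:E)%E]].
Proof.
move=> [eps [N [eps0 normN momN]]]; have [N0 _ _ _] := normN.
have [m [s [C [b [Ps C0 dec]]]]] :=
  support_decomposition (fun x => (0 < mu [set x])%E) normN.
pose w i := fine (mu [set s i]).
have ws i : step_weight mu (s i) (w i) by exact: step_weight_atom.
have w1 i : w i <= 1.
  by rewrite -lee_fin fineK ?fin_num_measure// probability_le1.
pose c := \prod_i w i.
have wc : step_weight mu (\sum_i s i) c by exact: step_weight_sum.
have c0 : 0 < c := wc.1.
exists b, (\sum_i s i), c; split=> // K K0.
have [C' C'0 hC'] := superexp_growth (K%:R / c) (C + 1) eps0.
exists (fun x => C' * expR (N (toR x) `^ (1 + eps))); split.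
- by move=> x; rewrite mulr_ge0// expR_ge0.
- apply/integrableP; split=> //.
  under eq_integral do rewrite /= ger0_norm ?mulr_ge0 ?expR_ge0// EFinM.
  rewrite ge0_integralZl_EFin//.
  by rewrite lte_mul_pinfty// lee_fin.
move=> f hf; have [q [q0 intq fq]] := harmonic_residual wc K0 hf.
have f0 x : 0 <= f x by exact: pos_harmonic_ge0 x hf.
exists q; split=> // x mux.
pose J := (Num.truncn (C * (N (toR x) + 1))).+1.
have CJ : C * (N (toR x) + 1) <= J%:R by rewrite ltW// truncnS_gt.
have JC : J%:R <= (C + 1) * (N (toR x) + 1).
  have : (Num.truncn (C * (N (toR x) + 1)))%:R <= C * (N (toR x) + 1).
    by rewrite truncn_le mulr_ge0// addr_ge0.
  by have := N0 (toR x); rewrite /J -natr1; lra.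
have [r [p [xJ p2J rb]]] := dec x J mux CJ.
apply: le_trans (fq J x) _; rewrite leeD2l// lee_fin.
have fxJ : c ^+ (2 * J) * f (x + (\sum_i s i) *+ J) <= f r.
  have [_ wp] : step_weight mu (\sum_i s i *+ p i) (\prod_i w i ^+ p i).
    by apply: step_weight_sum => i; exact: step_weightMn.
  apply: le_trans (wp f hf r); rewrite xJ ler_wpM2r// /c -prodrXl.
  apply: ler_prod => i _; rewrite exprn_ge0 ?(ltW (ws i).1)//=.
  by rewrite ler_wiXn2l ?(ltW (ws i).1).
have cJ0 : 0 < c ^+ (2 * J) by rewrite exprn_gt0.
(* Harnack loses [c^(2 J)] and the splitting gains [c^J]: the net loss [c^-J] goes
   into the base of the power, where [superexp_growth] applies *)
have GJ : (K%:R * c * J.+1%:R ^+ 2) ^+ J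
    = (K%:R / c * J.+1%:R ^+ 2) ^+ J * c ^+ (2 * J).
  rewrite exprM -exprMn; congr (_ ^+ _); field.
  by rewrite gt_eqF.
rewrite GJ -[leLHS]mulrA; apply: ler_pM => //.
- by rewrite exprn_ge0// mulr_ge0 ?exprn_ge0// divr_ge0// ltW.
- by rewrite mulr_ge0// ltW.
- exact: hC'.
- exact: le_trans fxJ (le_box_sum f0 rb).
Qed.

End Control.

Lemma cvgn_ubound (R : realType) (v : nat -> R) (l : R) :
  v n @[n --> \oo] --> l -> exists2 M, 0 <= M & forall n, v n <= M.
Proof.
move=> vl; have /cvg_seq_bounded [M [_ vM]] : cvgn v by apply/cvg_ex; exists l.
exists (`|M| + 1); first by rewrite addr_ge0.
move=> n; apply: le_trans (ler_norm _) _; apply: vM => //.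
by rewrite (le_lt_trans (ler_norm M))// ltrDl.
Qed.

Lemma cvgn_min_cst (R : realType) (v : nat -> R) (l a : R) :
  v n @[n --> \oo] --> l -> Num.min (v n) a @[n --> \oo] --> Num.min l a.
Proof.
move=> vl; rewrite minr_absE; under eq_fun do rewrite minr_absE.
apply: cvgMl; apply: cvgB.
  by apply: cvgD => //; exact: cvg_cst.
by apply: cvg_norm; apply: cvgB => //; exact: cvg_cst.
Qed.

Section Limit.
Context (R : realType) (d : nat) (mu : probability (lattice d) R).
Local Notation pos_harmonic := (pos_harmonic mu).
Variables (F : nat -> lattice d -> R) (f : lattice d -> R).
Hypothesis hF : forall n, pos_harmonic (F n).
Hypothesis Ff : forall x, F n x @[n --> \oo] --> f x.

Let F0 n x : 0 <= F n x.
Proof. exact: pos_harmonic_ge0 x (hF n). Qed.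

Let f0 x : 0 <= f x.
Proof.
apply: (@ler_cvg_to _ \oo _ _ (fun=> 0) (F ^~ x) 0); [exact: cvg_cst|exact: Ff|].
by apply: nearW => n; exact: F0.
Qed.

Let FfE x : (F n x)%:E @[n --> \oo] --> (f x)%:E.
Proof. by apply: cvg_EFin; [exact: nearW|exact: Ff]. Qed.

Lemma limit_superharmonic : (\int[mu]_x (f x)%:E <= (f 0)%:E)%E.
Proof.
have -> : (\int[mu]_x (f x)%:E = \int[mu]_x limn_einf (fun n => (F n x)%:E))%E.
  apply: eq_integral => x _; rewrite is_cvg_limn_einfE; first by apply/esym/cvg_lim.
  by apply/cvg_ex; exists (f x)%:E.
apply: le_trans (fatou mu measurableT _ _) _ => //.
  by move=> n x _; rewrite lee_fin.
under eq_fun do rewrite (pos_harmonic_int (hF _)).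
rewrite is_cvg_limn_einfE; first by rewrite (cvg_lim _ (@FfE 0)).
by apply/cvg_ex; exists (f 0)%:E.
Qed.

(** Dominated convergence for [min (F n) (D * M)]; the rest of [F n] is below the
residual, whose integral is at most [e] by the choice of [K]. *)
Lemma limit_subharmonic : finite_superexp_moment mu ->
  ((f 0)%:E <= \int[mu]_x (f x)%:E)%E.
Proof.
move=> /uniform_tail_control [b [s [c [c0 ctrl]]]].
have [M M0 FM] : exists2 M, 0 <= M & forall n, box_sum b (F n) <= M.
  apply: (@cvgn_ubound _ _ (box_sum b f)).
  by apply: cvg_big => [|v _]; [exact: add_continuous|exact: Ff].
have [L L0 FL] := cvgn_ubound (@Ff (- s)).
apply/lee_addgt0Pr => e e0.
pose K := (Num.truncn (L / (c * e))).+1.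
have KL : (c * K%:R)^-1 * L <= e.
  rewrite mulrC ler_pdivrMr ?mulr_gt0// mulrC mulrAC -ler_pdivrMl ?mulr_gt0//.
  by rewrite mulrC ltW// truncnS_gt.
have [D [D0 intD ctrlK]] := ctrl K isT.
pose g n x := (Num.min (F n x) (D x * M))%:E.
have g0 n x : (0 <= g n x)%E by rewrite lee_fin le_min F0 mulr_ge0.
have Fg n : ((F n 0)%:E <= \int[mu]_x g n x + e%:E)%E.
  have [q [q0 intq Fq]] := ctrlK (F n) (hF n).
  apply: (@le_trans _ _ (\int[mu]_x g n x + \int[mu]_x q x)%E); last first.
    rewrite leeD2l// (le_trans intq)// lee_fin (le_trans _ KL)//.
    by rewrite ler_wpM2l// invr_ge0 mulr_ge0// ltW.
  rewrite -ge0_integralD// -(pos_harmonic_int (hF n)).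
  apply: ae_ge0_le_integral => //.
  - by move=> x _; rewrite lee_fin.
  - by move=> x _; rewrite adde_ge0.
  apply: filterS (ae_atom mu) => x mux _.
  rewrite /g EFin_min; have [_|_] := leP (F n x)%:E (D x * M)%:E.
    by rewrite leeDl.
  rewrite addeC; apply: le_trans (Fq x mux) _.
  by rewrite leeD2l// lee_fin ler_wpM2l.
have gcvg : (\int[mu]_x g n x)%E @[n --> \oo]
    --> (\int[mu]_x (Num.min (f x) (D x * M))%:E)%E.
  have intDM : mu.-integrable setT (fun x => (M%:E * (D x)%:E)%E).
    exact: integrableZl.
  have [] // := @dominated_convergence _ _ _ mu setT measurableT g
    (fun x => (Num.min (f x) (D x * M))%:E) _ _ _ _ intDM.
  - apply: aeW => x _; apply: cvg_EFin; first exact: nearW.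
    exact: cvgn_min_cst.
  - apply: aeW => x n _; rewrite gee0_abs// -EFinM lee_fin mulrC.
    by rewrite ge_min lexx orbT.
apply: (@le_trans _ _
  (\int[mu]_x (Num.min (f x) (D x * M))%:E + e%:E)%E); last first.
  rewrite leeD2r// ge0_le_integral//.
  - by move=> x _; rewrite lee_fin le_min f0 mulr_ge0.
  - by move=> x _; rewrite lee_fin ge_min lexx.
have gecvg : (\int[mu]_x g n x + e%:E)%E @[n --> \oo]
    --> (\int[mu]_x (Num.min (f x) (D x * M))%:E + e%:E)%E.
  by apply: cvgeD; [exact: fin_num_adde_defl|exact: gcvg|exact: cvg_cst].
by apply: (lee_cvg_to (@FfE 0) gecvg); apply: nearW => n; exact: Fg.
Qed.
End Limit.

Theorem corollary2 (R : realType) (d : nat) (hd : (1 <= d)%N)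
    (mu : probability (lattice d) R)
    (hmu : finite_superexp_moment mu)
    (u : nat -> lattice d -> {nonneg R}) (f : lattice d -> {nonneg R})
    (hu : forall n : nat, harmonic_fun mu (u n))
    (huf : forall x : lattice d, (u n x)%:num @[n --> \oo] --> (f x)%:num) :
  harmonic_fun mu f.
Proof.
move=> x0.
pose F n x := (u n (x0 + x))%:num : R; pose f0 x := (f (x0 + x))%:num : R.
have hF n : pos_harmonic mu (F n).
  split=> x; first by rewrite /F.
  rewrite [RHS](hu n (x0 + x)).
  by apply: eq_integral => y _; rewrite /F addrA.
have Ff x : F n x @[n --> \oo] --> f0 x by exact: huf.
have -> : (f x0)%:num = f0 0 by rewrite /f0 addr0.
apply/eqP; rewrite eq_le.
by rewrite (limit_subharmonic hF Ff hmu) (limit_superharmonic hF Ff).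
Qed.
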